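(* Let $G=(V,E)$ be a finite simple undirected graph. The binary relation $\succeq$ on $V$ (defined in the context through adapted sequences of functions between path sets) is a preorder on $V$: for all $i,j,k\in V$, (Reflexivity) $i\succeq i$; (Transitivity) if $i\succeq k$ and $k\succeq j$, then $i\succeq j$.
   Context: $\mathbb{N}=\{1,2,3,\ldots\}$; $a\sim b$ means that $a,b\in V$ are neighbors in $G$; $d(a)$ is the degree of $a$. For $\ell\in\mathbb{N}$ and $i\in V$, the set of paths (walks) of length $\ell$ departing from $i$ is $$\mathcal{P}_\ell(i)=\{(i_0,i_1,\ldots,i_\ell)\in V^{\ell+1} : i_0=i,\ i_k\sim i_{k+1}\ \text{for } 0\le k\le \ell-1\}.$$ For $0\le m\le \ell$, $\pi_{\le m}(x_0,x_1,\ldots,x_\ell)=(x_0,\ldots,x_m)$. For a vector of nodes $\mathbf{p}$, $\mathbf{d}(\mathbf{p})$ is the vector of the degrees of its entries; inequalities between vectors are componentwise. For $i,j\in V$ and $\ell\in\mathbb{N}$, a function $f^\ell_{ji}:\mathcal{P}_\ell(j)\to\mathcal{P}_\ell(i)$ is called $\ell$-adapted at $(j,i)$ if for all $\mathbf{p},\widetilde{\mathbf{p}}\in\mathcal{P}_\ell(j)$ and all $m\le\ell$: $\pi_{\le m}(\mathbf{p})=\pi_{\le m}(\widetilde{\mathbf{p}})$ implies $\pi_{\le m}(f^\ell_{ji}(\mathbf{p}))=\pi_{\le m}(f^\ell_{ji}(\widetilde{\mathbf{p}}))$, and $\pi_{\le m}(\mathbf{p})\ne\pi_{\le m}(\widetilde{\mathbf{p}})$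 implies $\pi_{\le m}(f^\ell_{ji}(\mathbf{p}))\ne\pi_{\le m}(f^\ell_{ji}(\widetilde{\mathbf{p}}))$. An adapted sequence at $(j,i)$ is a sequence $(f^\ell_{ji})_{\ell\in\mathbb{N}}$ of $\ell$-adapted functions $f^\ell_{ji}:\mathcal{P}_\ell(j)\to\mathcal{P}_\ell(i)$ such that for every $\ell\in\mathbb{N}$, $f^{\ell+1}_{ji}$ extends $f^\ell_{ji}$, i.e. for all $\mathbf{p}\in\mathcal{P}_\ell(j)$ and $\mathbf{q}\in\mathcal{P}_{\ell+1}(j)$: if $\mathbf{p}=\pi_{\le\ell}(\mathbf{q})$ then $\pi_{\le\ell}(f^{\ell+1}_{ji}(\mathbf{q}))=f^\ell_{ji}(\mathbf{p})$, and if $\mathbf{p}\ne\pi_{\le\ell}(\mathbf{q})$ then $\pi_{\le\ell}(f^{\ell+1}_{ji}(\mathbf{q}))\ne f^\ell_{ji}(\mathbf{p})$. Definition of $\succeq$: $i\succeq j$ if there exists an adapted sequence $(f^\ell_{ji})_{\ell\in\mathbb{N}}$ at $(j,i)$ such that for all $\ell\in\mathbb{N}$, $f^\ell_{ji}$ is injective and $\mathbf{d}(f^\ell_{ji}(\mathbf{p}))\ge\mathbf{d}(\mathbf{p})$ for all $\mathbf{p}\in\mathcal{P}_\ell(j)$. *)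

(* Defs.v *)
From mathcomp Require Import all_boot.

Set Implicit Arguments.
Unset Strict Implicit.
Unset Printing Implicit Defensive.

(* A simple undirected graph on the finite vertex set V is a symmetric and
   irreflexive adjacency relation e : rel V; these two properties are
   hypotheses of the theorems, not needed by the definitions. *)
Section Graph.

Variables (V : finType) (e : rel V).

Definition degree (a : V) : nat := #|[set b | e a b]|.

(* P_l(i): (i_0, ..., i_l) with i_0 = i and i_k ~ i_(k+1) for all k < l. *)
Definition walk (l : nat) (i : V) : Type :=
  {p : l.+1.-tuple V | (thead p == i) && sorted e p}.

(* pi_(<= m) keeps m + 1 vertices.  It is valued in sequences, so that walks
   of different lengths can be compared through their initial segments. *)
Definition prefix_le (m l : nat) (i : V) (p : walk l i) : seq V :=
  take m.+1 (val p).

Definition adapted (l : nat) (j i : V) (f : walk l j -> walk l i) : Prop :=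
  forall (p p' : walk l j) (m : nat), m <= l ->
    (prefix_le m p = prefix_le m p' ->
       prefix_le m (f p) = prefix_le m (f p')) /\
    (prefix_le m p <> prefix_le m p' ->
       prefix_le m (f p) <> prefix_le m (f p')).

Definition extends (l : nat) (j i : V)
    (f' : walk l.+1 j -> walk l.+1 i) (f : walk l j -> walk l i) : Prop :=
  forall (p : walk l j) (q : walk l.+1 j),
    (val p = prefix_le l q :> seq V ->
       prefix_le l (f' q) = val (f p) :> seq V) /\
    (val p <> prefix_le l q :> seq V ->
       prefix_le l (f' q) <> val (f p) :> seq V).

(* Lengths range over {1, 2, ...}.  The value of the family at l = 0 is
   unconstrained; it carries no information, since walk 0 i has exactly one
   element for every i. *)
Definition adapted_sequence (j i : V)
    (f : forall l : nat, walk l j -> walk l i) : Prop :=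
  forall l : nat, 0 < l -> adapted (f l) /\ extends (f l.+1) (f l).

Definition degrees_le (l : nat) (j i : V) (p : walk l j) (q : walk l i) : Prop :=
  forall k : 'I_l.+1, degree (tnth (val p) k) <= degree (tnth (val q) k).

(* succeq i j is i >= j: the adapted sequence maps walks from j to walks
   from i. *)
Definition succeq (i j : V) : Prop :=
  exists f : forall l : nat, walk l j -> walk l i,
    adapted_sequence f /\
    forall l : nat, 0 < l ->
      injective (f l) /\ forall p : walk l j, degrees_le p (f l p).

End Graph.

(* Main.v *)
Require Import Defs.
From mathcomp Require Import all_boot.

(** Reflexivity is witnessed by the identity on walks of every length.  For
    transitivity, the walks from [j] are sent to walks from [k] and these to
    walks from [i].  Adaptedness and extension both say that agreement of
    initial segments is preserved and that disagreement is preserved, so each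
    of them passes to the composite, as do injectivity and the componentwise
    degree inequality.  For extension the point is that its hypothesis on a
    short walk [p] and a longer walk [q], and its conclusion on their images,
    are the same comparison up to orientation: the conclusion for the first
    map feeds the hypothesis for the second. *)

Set Implicit Arguments.
Unset Strict Implicit.
Unset Printing Implicit Defensive.

Section Preorder.

Variables (V : finType) (e : rel V).

Lemma adapted_comp (l : nat) (j k i : V)
    (g : walk e l k -> walk e l i) (h : walk e l j -> walk e l k) :
  adapted g -> adapted h -> adapted (g \o h).
Proof.
move=> gA hA p p' m lem.
have [hE hN] := hA p p' m lem; have [gE gN] := gA (h p) (h p') m lem.
by split=> [/hE/gE | /hN/gN].
Qed.

Lemma extends_comp (l : nat) (j k i : V)
    (g' : walk e l.+1 k -> walk e l.+1 i) (g : walk e l k -> walk e l i)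
    (h' : walk e l.+1 j -> walk e l.+1 k) (h : walk e l j -> walk e l k) :
  extends g' g -> extends h' h -> extends (g' \o h') (g \o h).
Proof.
move=> gX hX p q.
have [hE hN] := hX p q; have [gE gN] := gX (h p) (h' q).
by split=> [/hE/esym/gE | /hN/nesym/gN].
Qed.

Lemma succeq_refl (i : V) : succeq e i i.
Proof.
exists (fun l => @id (walk e l i)); split=> l _.
  by split=> // p q; split=> [/esym | /nesym].
by split=> // p n; apply: leqnn.
Qed.

Lemma succeq_trans (i k j : V) :
  succeq e i k -> succeq e k j -> succeq e i j.
Proof.
move=> [g [gS gP]] [h [hS hP]].
exists (fun l => g l \o h l); split=> l l_gt0.
  have [gA gX] := gS l l_gt0; have [hA hX] := hS l l_gt0.
  by split; [apply: adapted_comp | apply: extends_comp].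
have [g_inj g_deg] := gP l l_gt0; have [h_inj h_deg] := hP l l_gt0.
split; first exact: inj_comp.
by move=> p n; apply: leq_trans (h_deg p n) (g_deg (h l p) n).
Qed.

End Preorder.

Theorem theorem14 (V : finType) (e : rel V)
    (e_sym : symmetric e) (e_irrefl : irreflexive e) :
  forall i j k : V,
    succeq e i i /\ (succeq e i k -> succeq e k j -> succeq e i j).
Proof.
by move=> i j k; split; [apply: succeq_refl | apply: succeq_trans].
Qed.
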